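(* Let $a\in(0,1]$, $\delta\in[0,1)$, $C>0$, and let $\alpha$ be an irrational number with $\mu(\alpha)>1+\frac{a}{1-\delta}$. Then there is a family, of the cardinality of the continuum, of pairwise distinct skew products $T_{\alpha,h}:\mathbb{T}^2\to\mathbb{T}^2$, $T_{\alpha,h}(x,y)=(x+\alpha,y+h(x))$, with $h:\mathbb{T}\to\mathbb{T}$ continuous of degree zero, such that each member of the family is $a$-Hölder continuous, has $(C,\delta)$-deviation, is not $a'$-Hölder continuous for any $a<a'\le1$, and does not have $(C',\delta')$-deviation for any $C'>0$ and any $0\le\delta'<\delta$.
   Context: $\mathbb{T}=\mathbb{R}/\mathbb{Z}$, $\mathbb{T}^2=\mathbb{R}^2/\mathbb{Z}^2$, $\pi:\mathbb{R}^2\to\mathbb{T}^2$ is the covering projection, $|\cdot|$ is the Euclidean norm, $\|x\|_{\mathbb{T}^m}=\min_{y\in\mathbb{Z}^m}|x-y|$, which descends to $\mathbb{T}^m$ and gives its metric $d$. A map $g$ is $a$-Hölder if $d(g(x),g(y))\le M d(x,y)^a$ for some $M<\infty$ and all $x,y$. The irrationality measure $\mu(\alpha)$ is the supremum of all $r>0$ such that $|\alpha-p/q|<q^{-r}$ for infinitely many coprime $(p,q)\in\mathbb{Z}\times\mathbb{N}^+$. A homeomorphism $f$ of $\mathbb{T}^2$ isotopic to the identity, with lift $\tilde f$, is a pseudo-rotation if its rotation set $\rho(\tilde f)$ (the set of $v\in\mathbb{R}^2$ for which there are $\tilde z_i\in\mathbb{R}^2$, $n_i\to\infty$ with $(\tilde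 f^{n_i}(\tilde z_i)-\tilde z_i)/n_i\to v$) is a singleton; $\rho(\tilde f)$ is then identified with its unique element. When $\deg(h)=0$ and $\alpha$ is irrational, $T_{\alpha,h}$ is a pseudo-rotation. For a pseudo-rotation $f$, $n\ge1$, $z\in\mathbb{T}^2$ and any $\tilde z\in\pi^{-1}(z)$, put $\Delta_n(f,z)=\left|\frac{\tilde f^n(\tilde z)-\tilde z}{n}-\rho(\tilde f)\right|$ (independent of lifts), and $\Delta_N(f)=\sup_{n\ge N}\max_z\Delta_n(f,z)$. $f$ has $(C,\delta)$-deviation if $\Delta_N(f)\le CN^{\delta-1}$ for all integers $N\ge1$. *)

(* Defs.v *)
From HB Require Import structures.
From mathcomp Require Import all_boot all_order all_algebra.
From mathcomp Require Import generic_quotient ring_quotient.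
From mathcomp Require Import all_classical all_reals all_analysis.
Import Order.TTheory GRing.Theory Num.Theory.
Import numFieldNormedType.Exports.

Set Implicit Arguments.
Unset Strict Implicit.
Unset Printing Implicit Defensive.

Local Open Scope classical_set_scope.
Local Open Scope ring_scope.
Local Open Scope quotient_scope.

(* The circle R/Z, as the quotient group of R by its subgroup Num.int,
   with the quotient topology. *)
Definition circle (R : realType) : Type :=
  Quotient.quot (GRing.ZmodClosed.clone R (@Num.int_num_subdef R) _).

Section circle_instances.
Variable R : realType.
Local Notation Q :=
  (Quotient.quot (GRing.ZmodClosed.clone R (@Num.int_num_subdef R) _)).
HB.instance Definition _ := Quotient.on (circle R).
HB.instance Definition _ :=
  Topological.copy (circle R) (quotient_topology (circle R)).
(* The group structure is rebuilt, rather than copied from Q, because it has to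
   sit on the choice structure introduced by quotient_topology. *)
HB.instance Definition _ := GRing.isZmodule.Build (circle R)
  (@addrA Q) (@addrC Q) (@add0r Q) (@addNr Q).
End circle_instances.

Notation plane R := (R * R)%type.
(* R^2/Z^2 is identified with (R/Z) x (R/Z). *)
Notation torus R := (circle R * circle R)%type.

Section defs.
Variable R : realType.
Implicit Types (x : R) (v w : plane R) (z : torus R).

Definition circle_proj x : circle R := \pi_(circle R) x.

Definition torus_proj v : torus R := (circle_proj v.1, circle_proj v.2).

Definition torus_repr z : plane R := (repr z.1, repr z.2).

(* The canonical norm on R * R is the sup norm. *)
Definition enorm v : R := Num.sqrt (v.1 ^+ 2 + v.2 ^+ 2).

(* Distance to the lattice Z^2; the infimum is attained. *)
Definition lattice_norm v : R :=
  inf (range (fun k : int * int => enorm (v - (k.1%:~R, k.2%:~R)))).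

(* lattice_norm is Z^2-periodic, so the choice of representatives is
   immaterial. *)
Definition torus_dist z1 z2 : R :=
  lattice_norm (torus_repr z1 - torus_repr z2).

Definition holder (a : R) (g : torus R -> torus R) : Prop :=
  exists M : R, forall z1 z2,
    torus_dist (g z1) (g z2) <= M * torus_dist z1 z2 `^ a.

Definition irrationality_measure (alpha : R) : \bar R :=
  ereal_sup [set r%:E | r in [set r : R | 0 < r /\
    infinite_set [set pq : int * nat |
      [/\ (0 < pq.2)%N, coprime `|pq.1|%N pq.2 &
          `|alpha - pq.1%:~R / pq.2%:R| < pq.2%:R `^ (- r)]]]].

Definition has_degree (h : circle R -> circle R) (k : int) : Prop :=
  exists H : R -> R,
    [/\ continuous H, forall x, circle_proj (H x) = h (circle_proj x) &
        forall x, H (x + 1) = H x + k%:~R].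

Definition skew_product (alpha : R) (h : circle R -> circle R) z : torus R :=
  (z.1 + circle_proj alpha, z.2 + h z.1).

Definition homeomorphism (f : torus R -> torus R) : Prop :=
  continuous f /\
  exists g : torus R -> torus R, [/\ continuous g, cancel f g & cancel g f].

Definition isotopic_to_id (f : torus R -> torus R) : Prop :=
  exists H : R -> torus R -> torus R,
    [/\ {within [set p : R * torus R | 0 <= p.1 <= 1],
          continuous (fun p : R * torus R => H p.1 p.2)},
        forall t, 0 <= t <= 1 -> homeomorphism (H t),
        H 0 = id & H 1 = f].

Definition is_lift (f : torus R -> torus R) (F : plane R -> plane R) : Prop :=
  continuous F /\ forall v, torus_proj (F v) = f (torus_proj v).

Definition mean_displacement (F : plane R -> plane R) (n : nat) v : plane R :=
  n%:R^-1 *: (iter n F v - v).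

Definition rotation_set (F : plane R -> plane R) : set (plane R) :=
  [set v | exists (w : nat -> plane R) (n : nat -> nat),
    n @ \oo --> \oo /\
    (fun i => mean_displacement F (n i) (w i)) @ \oo --> v].

Definition pseudo_rotation (f : torus R -> torus R) : Prop :=
  [/\ homeomorphism f, isotopic_to_id f &
      exists F, is_lift f F /\ exists rho, rotation_set F = [set rho]].

Definition lift_of (f : torus R -> torus R) : plane R -> plane R :=
  xget (id : plane R -> plane R) [set F | is_lift f F].

(* For a pseudo-rotation, the unique element of the rotation set of the chosen
   lift. *)
Definition rotation_vector (f : torus R -> torus R) : plane R :=
  xget 0 (rotation_set (lift_of f)).

(* For a pseudo-rotation this does not depend on the lift of f (two lifts differ
   by a constant vector of Z^2, which shifts the rotation vector accordingly),
   nor on the representative of z. *)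
Definition Delta (f : torus R -> torus R) (n : nat) z : R :=
  enorm (mean_displacement (lift_of f) n (torus_repr z) - rotation_vector f).

(* For a pseudo-rotation, the inner supremum is a maximum, as Delta f n is
   continuous on the torus. *)
Definition Delta_sup (f : torus R -> torus R) (N : nat) : \bar R :=
  ereal_sup [set ereal_sup (range (fun z => (Delta f n z)%:E)) |
             n in [set n | (N <= n)%N]].

Definition has_deviation (C delta : R) (f : torus R -> torus R) : Prop :=
  pseudo_rotation f /\
  forall N : nat, (1 <= N)%N ->
    (Delta_sup f N <= (C * N%:R `^ (delta - 1))%:E)%E.

End defs.

(* Main.v *)
Require Import Defs.
From mathcomp Require Import all_boot all_order all_algebra.
From mathcomp Require Import generic_quotient ring_quotient.
From mathcomp Require Import all_classical all_reals all_analysis.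
From mathcomp Require Import ring lra.
Import Order.TTheory GRing.Theory Num.Theory.
Import numFieldNormedType.Exports.
Local Open Scope classical_set_scope.
Local Open Scope ring_scope.

(** The forcing is written as a formal coboundary, h = V(x + alpha) - V(x) with
[[
V(x) = eta |sin(pi x)|^a + sum_k b_k (1 - cos(2 pi q_k x)),
]]
    where p_k/q_k are excellent rational approximations of alpha,
    beta_k = |q_k alpha - p_k| and b_k = kappa 2^-(k+1) beta_k^-delta.  The
    amplitudes b_k are unbounded for delta > 0, so V itself makes no sense, but
    every difference V(x + n alpha) - V(x), which is the n-th Birkhoff sum of h,
    is a series dominated by a geometric one.

    Upper bounds.  The k-th term of the n-th Birkhoff sum is at most
    2 b_k min(1, pi n beta_k), and min(1, t) <= t^delta turns this into a
    constant times 2^-k n^delta ([wave_diff_dominated]).  The k-th term of h is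
    2 b_k sin(pi q_k alpha) times a wave of frequency q_k; its a-Hoelder
    constant is of order 2^-k beta_k^(1-delta) q_k^a, and the hypothesis on the
    irrationality measure of alpha is exactly what allows
    beta_k^(1-delta) q_k^a <= 1 with q_k arbitrarily large
    ([exists_good_approximation], [forcing_holder]).

    Lower bounds.  Both come from signs, so that no tail of a series has to be
    compared with a main term.  V >= 0 = V(0), hence the n-th Birkhoff sum at 0
    dominates each single term; for n close to 1/(2 beta_k) the k-th one is at
    least b_k, of order 2^-k n^delta, and the beta_k are chosen so small
    that 2^-k cannot compensate a gain n^(delta-delta')
    ([birkhoff_sum_unbounded]).  For small x the second difference of h at 0 is
    nonpositive for each wave and for the cusp of V(x + alpha), while the cusp
    of -V(x) contributes - 2 eta |sin(pi x)|^a; hence h is not a'-Hoelder at 0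
    for a' > a ([forcing_second_difference], [forcing_not_holder]).

    The parameter eta ranges over a set with the cardinality of the continuum.
    The remaining work transfers these facts about a function on the line to the
    torus: continuous maps descend because the projection is open, two lifts
    differ by an integer vector, and the orbits of the lifted skew product are
    Birkhoff sums. *)

(** * Maps on the circle and the torus *)

Section continuity.
Implicit Types S T U : topologicalType.

Lemma continuous_comp_fun {S T U} (f : S -> T) (g : T -> U) :
  continuous f -> continuous g -> continuous (fun x => g (f x)).
Proof. by move=> cf cg x; apply: continuous_comp; [exact: cf|exact: cg]. Qed.

Lemma continuous_fst {S T} : continuous (@fst S T).
Proof. by move=> [s t]; exact: cvg_fst. Qed.

Lemma continuous_snd {S T} : continuous (@snd S T).
Proof. by move=> [s t]; exact: cvg_snd. Qed.

Lemma continuous_pair {S T U} (f : S -> T) (g : S -> U) :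
  continuous f -> continuous g -> continuous (fun x => (f x, g x)).
Proof. by move=> cf cg x; apply: cvg_pair; [exact: cf|exact: cg]. Qed.

Lemma continuous_addr {S} {K : numFieldType} (f g : S -> K) :
  continuous f -> continuous g -> continuous (fun x => f x + g x).
Proof. by move=> cf cg x; apply: cvgD; [exact: cf|exact: cg]. Qed.

Lemma continuous_mulr {S} {K : numFieldType} (f g : S -> K) :
  continuous f -> continuous g -> continuous (fun x => f x * g x).
Proof. by move=> cf cg x; apply: cvgM; [exact: cf|exact: cg]. Qed.

End continuity.

Section nbhs_preserving_maps.
Implicit Types S T X : topologicalType.

(** Openness of [p], in the pointwise form that combines best with products. *)
Definition nbhs_map {S T} (p : S -> T) :=
  forall s (U : set S), nbhs s U -> nbhs (p s) (p @` U).

Lemma nbhs_map_id {S} : nbhs_map (@id S).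
Proof. by move=> s U; rewrite image_id. Qed.

Lemma nbhs_map_pair {S1 S2 T1 T2 : topologicalType}
    (p1 : S1 -> T1) (p2 : S2 -> T2) :
  nbhs_map p1 -> nbhs_map p2 ->
  nbhs_map (fun s : S1 * S2 => (p1 s.1, p2 s.2)).
Proof.
move=> o1 o2 [s1 s2] U [[A B] /= [As Bs] AB].
exists (p1 @` A, p2 @` B); first by split; [exact: o1|exact: o2].
move=> [t1 t2] /= [[x Ax <-] [y By <-]].
by exists (x, y) => //; exact: AB.
Qed.

(** An open surjection is a quotient map. *)
Lemma continuous_factor {S T X} (p : S -> T) (f : T -> X) :
  nbhs_map p -> (forall t, exists s, p s = t) -> continuous (f \o p) ->
  continuous f.
Proof.
move=> op surj cf t; have [s <-] := surj t => V nV.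
apply: filterS (op _ _ (cf s V nV)).
by move=> _ [x Vx <-].
Qed.

End nbhs_preserving_maps.

Section circle_theory.
Context {R : realType}.
Implicit Types (x y : R) (m : int).

Lemma circle_projP x y :
  circle_proj x = circle_proj y <-> exists m, x = y + m%:~R.
Proof.
pose Z := GRing.ZmodClosed.clone R (@Num.int_num_subdef R) _.
have iE : (x - y \is a Num.int) = (x == y %[mod Quotient.quot Z])%qT.
  exact: Quotient.idealrBE.
split => [xy|[m xym]].
  have /intrP[m xym] : x - y \is a Num.int by rewrite iE; apply/eqP.
  by exists m; rewrite -xym addrC subrK.
have : x - y \is a Num.int by apply/intrP; exists m; rewrite xym addrAC subrr add0r.
by rewrite iE => /eqP.
Qed.

Lemma circle_projD x y : circle_proj (x + y) = circle_proj x + circle_proj y.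
Proof.
pose Z := GRing.ZmodClosed.clone R (@Num.int_num_subdef R) _.
exact: (raddfD (\pi_(Quotient.quot Z))%qT).
Qed.

Lemma circle_reprK (z : circle R) : circle_proj (repr z) = z.
Proof. exact: reprK. Qed.

Lemma circle_proj_intD x m : circle_proj (x + m%:~R) = circle_proj x.
Proof. by apply/circle_projP; exists m. Qed.

Lemma circle_proj_continuous : continuous (@circle_proj R).
Proof. exact: pi_continuous. Qed.

(** The saturation of an open set of the line is the union of its integer
    translates, hence open. *)
Lemma circle_proj_nbhs x (U : set R) :
  nbhs x U -> nbhs (circle_proj x) (@circle_proj R @` U).
Proof.
rewrite nbhsE => -[V [oV Vx] VU].
suff oW : open (@circle_proj R @` V).
  apply: (@filterS _ _ _ (@circle_proj R @` V)); first exact: image_subset.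
  by apply: open_nbhs_nbhs; split => //; exists x.
have preE : @circle_proj R @^-1` (@circle_proj R @` V) =
    \bigcup_(m : int) ((fun y => y + m%:~R) @^-1` V).
  apply/seteqP; split => [y [v Vv /circle_projP[m vym]]|y [m _ /= Vy]].
    by exists m => //=; rewrite -vym.
  by exists (y + m%:~R) => //; exact: circle_proj_intD.
have : open (@circle_proj R @^-1` (@circle_proj R @` V)).
  rewrite preE; apply: bigcup_open => m _; apply: open_comp => // y _.
  by apply: cvgD; [exact: cvg_id|exact: cvg_cst].
by [].
Qed.

End circle_theory.

Section torus_theory.
Context {R : realType}.
Implicit Types (x y al : R) (m : int) (v w : plane R) (z : torus R) (H : R -> R).

Lemma torus_projP v w : torus_proj v = torus_proj w <->
  exists k : int * int, v = w + (k.1%:~R, k.2%:~R).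
Proof.
rewrite /torus_proj; split => [[/circle_projP[m1 e1] /circle_projP[m2 e2]]|[k ->]].
  by exists (m1, m2); rewrite [LHS]surjective_pairing e1 e2.
by congr pair; apply/circle_projP; eexists.
Qed.

Lemma torus_reprK z : torus_proj (torus_repr z) = z.
Proof. by case: z => z1 z2; rewrite /torus_proj !circle_reprK. Qed.

Lemma torus_proj_nbhs : nbhs_map (@torus_proj R).
Proof. apply: nbhs_map_pair; exact: circle_proj_nbhs. Qed.

Lemma torus_proj_continuous : continuous (@torus_proj R).
Proof.
apply: continuous_pair; apply: continuous_comp_fun (@circle_proj_continuous R).
  exact: continuous_fst.
exact: continuous_snd.
Qed.

Definition int_periodic H := forall x m, H (x + m%:~R) = H x.

Definition descend H (z : circle R) : circle R := circle_proj (H (repr z)).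

Lemma repr_circle_proj H x : int_periodic H -> H (repr (circle_proj x)) = H x.
Proof.
move=> pH; have /circle_projP[m ->] := circle_reprK (circle_proj x).
exact: pH.
Qed.

Lemma descend_proj H x : int_periodic H ->
  descend H (circle_proj x) = circle_proj (H x).
Proof. by move=> pH; rewrite /descend repr_circle_proj. Qed.

Lemma descend_continuous H : int_periodic H -> continuous H ->
  continuous (descend H).
Proof.
move=> pH cH; apply: (continuous_factor (@circle_proj R)).
- exact: circle_proj_nbhs.
- by move=> z; exists (repr z); exact: circle_reprK.
- rewrite (_ : _ \o _ = @circle_proj R \o H).
    by move=> x; apply: continuous_comp; [exact: cH|exact: circle_proj_continuous].
  by apply/funext => x /=; exact: descend_proj.
Qed.

Definition skew_lift al H v : plane R := (v.1 + al, v.2 + H v.1).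

Lemma skew_lift_continuous al H : continuous H -> continuous (skew_lift al H).
Proof.
move=> cH; apply: continuous_pair; apply: continuous_addr.
- exact: continuous_fst.
- by move=> v; exact: cvg_cst.
- exact: continuous_snd.
- exact: (continuous_comp_fun _ _ continuous_fst cH).
Qed.

Lemma skew_product_proj al H v : int_periodic H ->
  skew_product al (descend H) (torus_proj v) = torus_proj (skew_lift al H v).
Proof.
by move=> pH; rewrite /skew_product /torus_proj /= descend_proj// !circle_projD.
Qed.

Lemma is_lift_skew al H : int_periodic H -> continuous H ->
  is_lift (skew_product al (descend H)) (skew_lift al H).
Proof.
move=> pH cH; split; first exact: skew_lift_continuous.
by move=> v; rewrite skew_product_proj.
Qed.

Lemma continuous_of_lift (f : torus R -> torus R) F : is_lift f F -> continuous f.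
Proof.
move=> [cF fF]; apply: (continuous_factor (@torus_proj R)).
- exact: torus_proj_nbhs.
- by move=> z; exists (torus_repr z); exact: torus_reprK.
- rewrite (_ : _ \o _ = @torus_proj R \o F); last by apply/funext => v; rewrite /= fF.
  by move=> v; apply: continuous_comp; [exact: cF|exact: torus_proj_continuous].
Qed.

(** The inverse is the skew product over the inverse rotation with forcing
    - H (x - al). *)
Lemma homeomorphism_skew al H : int_periodic H -> continuous H ->
  homeomorphism (skew_product al (descend H)).
Proof.
move=> pH cH; split; first exact: (continuous_of_lift _ _ (is_lift_skew al H pH cH)).
pose K x := - H (x - al).
have pK : int_periodic K by move=> x m; rewrite /K addrAC pH.
have cK : continuous K.
  move=> x; apply: cvgN; apply: continuous_comp; last exact: cH.
  by apply: cvgB; [exact: cvg_id|exact: cvg_cst].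
exists (skew_product (- al) (descend K)); split.
- exact: (continuous_of_lift _ _ (is_lift_skew _ _ pK cK)).
- move=> z; rewrite -(torus_reprK z) !skew_product_proj//; congr torus_proj.
  by rewrite /skew_lift /K /= !addrK.
- move=> z; rewrite -(torus_reprK z) !skew_product_proj//; congr torus_proj.
  by rewrite /skew_lift /K /= !subrK.
Qed.

(** The isotopy scales both the rotation and the forcing by the time; it is
    continuous because its lift is. *)
Lemma isotopic_to_id_skew al H : int_periodic H -> continuous H ->
  isotopic_to_id (skew_product al (descend H)).
Proof.
move=> pH cH; pose K t x := t * H x.
have pK t : int_periodic (K t) by move=> x m; rewrite /K pH.
have cK t : continuous (K t).
  by move=> x; apply: cvgM; [exact: cvg_cst|exact: cH].
exists (fun t => skew_product (t * al) (descend (K t))); split.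
- apply: continuous_subspaceT.
  apply: (continuous_factor (fun w : R * plane R => (w.1, torus_proj w.2))).
  + exact: (nbhs_map_pair id (@torus_proj R) nbhs_map_id torus_proj_nbhs).
  + by move=> [t z]; exists (t, torus_repr z); rewrite torus_reprK.
  + rewrite (_ : _ \o _ = @torus_proj R \o
      (fun w : R * plane R => skew_lift (w.1 * al) (K w.1) w.2)).
      apply: (continuous_comp_fun _ (@torus_proj R) _ torus_proj_continuous).
      have c2 := @continuous_snd R (plane R).
      have c21 := continuous_comp_fun _ _ c2 continuous_fst.
      have c22 := continuous_comp_fun _ _ c2 continuous_snd.
      apply: continuous_pair; apply: continuous_addr => //; apply: continuous_mulr.
      - exact: continuous_fst.
      - by move=> w; exact: cvg_cst.
      - exact: continuous_fst.
      - exact: (continuous_comp_fun _ _ c21 cH).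
    by apply/funext => -[t v] /=; rewrite skew_product_proj.
- by move=> t _; exact: homeomorphism_skew.
- apply/funext => z; rewrite -(torus_reprK z) skew_product_proj//; congr torus_proj.
  by rewrite /skew_lift /K !mul0r !addr0.
- rewrite mul1r; congr (skew_product _ (descend _)).
  by apply/funext => x; rewrite /K mul1r.
Qed.

End torus_theory.

(** * Lifts, rotation sets and deviations of skew products *)

Section lifts.
Context {R : realType}.
Implicit Types (x y al : R) (m : int) (k : int * int) (v w : plane R) (H : R -> R).

(** Otherwise the intermediate value theorem yields a half-integer value. *)
Lemma continuous_int_valued_cst (g : R -> R) :
  continuous g -> (forall t, exists m, g t = m%:~R) -> g 1 = g 0.
Proof.
move=> cg intg; apply/eqP/negP => /negP ne.
have [m0 e0] := intg 0; have [m1 e1] := intg 1.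
have mid : exists m, Num.min (g 0) (g 1) = m%:~R /\
    m%:~R + 1 <= Num.max (g 0) (g 1).
  move: ne; rewrite e0 e1 eqr_int neq_lt => /orP[] lt.
    exists m1; rewrite minEle maxEle !ler_int leNgt lt/=; split => //.
    by rewrite (_ : 1 = 1%:~R)// -intrD ler_int lezD1.
  exists m0; rewrite minEle maxEle !ler_int (ltW lt)/=; split => //.
  by rewrite (_ : 1 = 1%:~R)// -intrD ler_int lezD1.
have [m [mn mx]] := mid.
have [|c _ gc] := @IVT R g 0 1 (m%:~R + 2^-1) ler01 (continuous_subspaceT cg).
  by rewrite mn lerDl invr_ge0 ler0n/= (le_trans _ mx)// lerD2l; lra.
have [j ej] := intg c.
have : 0 < ((j - m)%:~R : R) < 1.
  by rewrite intrB -ej gc addrAC subrr add0r; lra.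
by rewrite -[1]/(1%:~R) ltr0z ltrz1; case: (j - m) => [[|?]|?].
Qed.

Definition zplane k : plane R := (k.1%:~R, k.2%:~R).

(** Along the ray from 0 to v, both coordinates of G - F are continuous and take
    integer values. *)
Lemma lifts_differ_by_constant (f : torus R -> torus R) F G :
  is_lift f F -> is_lift f G -> exists k, forall v, G v = F v + zplane k.
Proof.
move=> [cF fF] [cG fG].
have diff v : exists k, G v = F v + zplane k.
  by apply/torus_projP; rewrite fF fG.
have [k0 e0] := diff 0; exists k0 => v; have [kv ev] := diff v.
rewrite ev; congr (_ + _).
have ray : continuous (fun t : R => t *: v).
  by move=> t; apply: cvgZ; [exact: cvg_id|exact: cvg_cst].
have cst (p : plane R -> R) : continuous p -> {morph p : v w / v + w} ->
    (forall k, exists m, p (zplane k) = m%:~R) ->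
    p (zplane kv) = p (zplane k0).
  move=> cp pD pZ.
  pose g t := p (G (t *: v)) - p (F (t *: v)).
  have gE t k : G (t *: v) = F (t *: v) + zplane k -> g t = p (zplane k).
    by rewrite /g => ->; rewrite pD addrC addKr.
  have cg : continuous g.
    move=> t; apply: cvgB.
      exact: (continuous_comp_fun _ _ (continuous_comp_fun _ _ ray cG) cp).
    exact: (continuous_comp_fun _ _ (continuous_comp_fun _ _ ray cF) cp).
  have <- : g 1 = p (zplane kv) by apply: gE; rewrite scale1r.
  have <- : g 0 = p (zplane k0) by apply: gE; rewrite scale0r.
  apply: continuous_int_valued_cst cg _ => t.
  by have [k /gE ->] := diff (t *: v); exact: pZ.
rewrite [LHS]surjective_pairing [RHS]surjective_pairing; congr pair.
  by apply: (cst fst) => //; [exact: continuous_fst|by move=> k; exists k.1].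
by apply: (cst snd) => //; [exact: continuous_snd|by move=> k; exists k.2].
Qed.

Lemma mulr_powRB1_gt0 x (p : R) : 0 < x -> x * x `^ (p - 1) = x `^ p.
Proof.
move=> x0; rewrite -{1}(powRr1 (ltW x0)) -powRD ?(gt_eqF x0) ?implybT//.
by rewrite addrC subrK.
Qed.

Lemma cvg_powR_natr_neg (p : R) : p < 0 -> (fun n => n%:R `^ p) @ \oo --> (0 : R).
Proof.
move=> p0; have Np0 : 0 < - p by rewrite oppr_gt0.
apply/cvgrPdist_lt => e e0; near=> n.
have ne : e `^ p^-1 < n%:R by near: n; exact: nbhs_infty_gtr.
have n0 : 0 < n%:R :> R by apply: le_lt_trans ne; exact: powR_ge0.
rewrite sub0r normrN ger0_norm ?powR_ge0// -[p]opprK powRN.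
rewrite invf_plt ?posrE ?powR_gt0//.
have := gt0_ltr_powR Np0 _ _ ne; rewrite !nnegrE powR_ge0 ler0n => /(_ isT isT).
by rewrite -powRrM mulrN mulVf ?lt_eqF// powR_inv1 ?ltW.
Unshelve. all: by end_near. Qed.

Section skew_orbits.
Variables (al : R) (H : R -> R).
Hypothesis pH : int_periodic H.
Hypothesis cH : continuous H.

Let f := skew_product al (descend H).
Let F := skew_lift al H.

Definition birkhoff_sum n x : R := \sum_(i < n) H (x + i%:R * al).

Lemma iter_skew_lift n v :
  iter n F v = (v.1 + n%:R * al, v.2 + birkhoff_sum n v.1).
Proof.
elim: n => [|n ih].
  by rewrite mul0r /birkhoff_sum big_ord0 !addr0; case: v.
rewrite iterS ih /F /skew_lift /= /birkhoff_sum big_ord_recr/= addrA.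
by rewrite -natr1 mulrDl mul1r addrA.
Qed.

Lemma birkhoff_sum_periodic n : int_periodic (birkhoff_sum n).
Proof. by move=> x m; apply: eq_bigr => i _; rewrite addrAC pH. Qed.

Lemma skew_lift_zplane v k : F (v + zplane k) = F v + zplane k.
Proof.
rewrite /F /skew_lift /= pH.
by rewrite [RHS]surjective_pairing /= addrAC (addrAC v.2).
Qed.

(** F commutes with integer translations, so adding a constant k to F adds
    n k to its n-th iterate. *)
Lemma mean_displacement_lift G k n v : (forall v, G v = F v + zplane k) ->
  (0 < n)%N ->
  mean_displacement G n v =
  (al + k.1%:~R, n%:R^-1 * birkhoff_sum n v.1 + k.2%:~R).
Proof.
move=> GE n0; have nn0 : n%:R != 0 :> R by rewrite pnatr_eq0 -lt0n.
have iterG j : iter j G v = iter j F v + j%:R *: zplane k.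
  elim: j => [|j ih]; first by rewrite scale0r addr0.
  have jE : j%:R *: zplane k = zplane (k.1 * j%:Z, k.2 * j%:Z).
    by rewrite /zplane /= !intrM -!pmulrn; congr pair; rewrite /= mulrC.
  rewrite !iterS GE ih jE skew_lift_zplane -jE -addrA; congr (_ + _).
  by rewrite -natr1 scalerDl scale1r.
rewrite /mean_displacement iterG iter_skew_lift.
rewrite [LHS]surjective_pairing /=; congr pair.
  by rewrite /GRing.scale/=; field.
by rewrite /GRing.scale/=; field.
Qed.

Variables c d : R.
Hypothesis d_lt1 : d < 1.
Hypothesis birkhoff_le : forall n x, (0 < n)%N ->
  `|birkhoff_sum n x| <= c * n%:R `^ d.

Let rate n := c * n%:R `^ (d - 1).

Let rate_cvg : rate @ \oo --> (0 : R).
Proof.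
rewrite -(mulr0 c); apply: cvgM; first exact: cvg_cst.
by apply: cvg_powR_natr_neg; rewrite subr_lt0.
Qed.

Let rateP n x : (0 < n)%N -> `|n%:R^-1 * birkhoff_sum n x| <= rate n.
Proof.
move=> n0; have nR : 0 < n%:R :> R by rewrite ltr0n.
rewrite normrM normfV normr_nat ler_pdivrMl// (le_trans (birkhoff_le _ _ n0))//.
by rewrite /rate mulrCA mulr_powRB1_gt0.
Qed.

Lemma rotation_set_lift G k : (forall v, G v = F v + zplane k) ->
  rotation_set G = [set (al + k.1%:~R, k.2%:~R)].
Proof.
move=> GE; have mdE n v := mean_displacement_lift G k n v GE.
have pos (n : nat -> nat) : n @ \oo --> \oo -> \forall i \near \oo, (0 < n i)%N.
  by move=> noo; apply: (noo [set j | (0 < j)%N]); exists 1%N.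
have lim_md (n : nat -> nat) (w : nat -> plane R) : n @ \oo --> \oo ->
    (fun i => mean_displacement G (n i) (w i)) @ \oo -->
    ((al + k.1%:~R, k.2%:~R) : plane R).
  move=> noo.
  have sq : (fun i => (n i)%:R^-1 * birkhoff_sum (n i) (w i).1) @ \oo --> (0 : R).
    have rn : (rate \o n) @ \oo --> (0 : R) by exact: (cvg_comp _ _ noo rate_cvg).
    apply/norm_cvg0P; apply: (squeeze_cvgr _ (cvg_cst _) rn).
    near=> i; rewrite normr_ge0/=; apply: rateP.
    by near: i; exact: pos.
  have : (fun i => (al + k.1%:~R,
        (n i)%:R^-1 * birkhoff_sum (n i) (w i).1 + k.2%:~R) : plane R)
      @ \oo --> ((al + k.1%:~R, k.2%:~R) : plane R).
    have c1 : (fun=> al + k.1%:~R) @ \oo --> (al + k.1%:~R : R) by exact: cvg_cst.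
    have c2 : (fun i => (n i)%:R^-1 * birkhoff_sum (n i) (w i).1 + k.2%:~R) @ \oo
        --> (k.2%:~R : R).
      by rewrite -[X in _ --> X]add0r; apply: cvgD => //; exact: cvg_cst.
    exact: (cvg_pair c1 c2).
  apply: cvg_trans; apply: near_eq_cvg; near=> i; rewrite mdE//.
  by near: i; exact: pos.
apply/seteqP; split => [v [w [n [noo vlim]]]|_ ->].
  exact: (cvg_unique _ vlim (lim_md n w noo)).
by exists (fun=> 0), id; split; [exact: cvg_id|exact: lim_md].
Unshelve. all: by end_near. Qed.

Lemma pseudo_rotation_skew : pseudo_rotation f.
Proof.
split; [exact: homeomorphism_skew|exact: isotopic_to_id_skew|].
exists F; split; first exact: is_lift_skew.
exists (al, 0); rewrite (@rotation_set_lift F (0, 0)) ?addr0//.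
by move=> v; rewrite /zplane /= addr0.
Qed.

(** The integer vector that separates the chosen lift from [skew_lift] cancels
    against the one in its rotation vector. *)
Lemma Delta_skew n z : (0 < n)%N ->
  Delta f n z = `|n%:R^-1 * birkhoff_sum n (repr z.1)|.
Proof.
move=> n0; have lF : is_lift f F by exact: is_lift_skew.
have lG : is_lift f (lift_of f).
  by apply: (@xgetPex _ _ [set G | is_lift f G]); exists F.
have [k GE] := lifts_differ_by_constant f F (lift_of f) lF lG.
rewrite /Delta /rotation_vector (rotation_set_lift _ k GE).
rewrite (_ : xget 0 _ = (al + k.1%:~R, k.2%:~R)); last first.
  by apply: (@xget_unique _ _ [set _]).
rewrite (mean_displacement_lift _ k _ _ GE n0) /enorm /=.
by rewrite subrr expr0n add0r addrK sqrtr_sqr.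
Qed.

Lemma has_deviation_skew : has_deviation c d f.
Proof.
split; first exact: pseudo_rotation_skew.
have c0 : 0 <= c.
  by have := birkhoff_le 1%N 0 isT; rewrite powR1 mulr1; apply: le_trans.
move=> N N0; apply: ge_ereal_sup => _ [n /= Nn <-].
apply: ge_ereal_sup => _ [z _ <-]; rewrite lee_fin.
have n0 : (0 < n)%N by exact: leq_trans Nn.
have nR : 0 < n%:R :> R by rewrite ltr0n.
have NR : 0 < N%:R :> R by rewrite ltr0n.
rewrite Delta_skew// (le_trans (rateP _ _ n0))//.
rewrite ler_wpM2l// -(opprB 1) !powRN lef_pV2 ?posrE ?powR_gt0//.
by rewrite ge0_ler_powR ?nnegrE ?ler0n ?ler_nat// subr_ge0 ltW.
Qed.

(** Evaluate the deviation at the class of (0, 0); periodicity removes the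
    choice of a representative. *)
Lemma birkhoff_sum_le_deviation C de n : has_deviation C de f -> (0 < n)%N ->
  birkhoff_sum n 0 <= C * n%:R `^ de.
Proof.
move=> [_ dev] n0; have nR : 0 < n%:R :> R by rewrite ltr0n.
pose z : torus R := (circle_proj 0, circle_proj 0).
have : ((Delta f n z)%:E <= (C * n%:R `^ (de - 1))%:E)%E.
  apply: le_trans (dev n n0).
  apply: (le_trans (y := ereal_sup (range (fun z => (Delta f n z)%:E)))).
    by apply: ereal_sup_ubound; exists z.
  by apply: ereal_sup_ubound; exists n => /=.
rewrite lee_fin Delta_skew// /z/= (repr_circle_proj _ _ (birkhoff_sum_periodic n)).
rewrite normrM normfV normr_nat ler_pdivrMl// mulrCA mulr_powRB1_gt0//.
by apply: le_trans; exact: ler_norm.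
Qed.

End skew_orbits.
End lifts.

(** * Hoelder continuity on the torus *)

Section torus_metric.
Context {R : realType}.
Implicit Types (x y al : R) (m : int) (k : int * int) (v w : plane R) (H : R -> R).

Lemma enorm_ge0 v : 0 <= enorm v. Proof. exact: sqrtr_ge0. Qed.

Lemma fst_le_enorm v : `|v.1| <= enorm v.
Proof. by rewrite -sqrtr_sqr ler_wsqrtr// lerDl sqr_ge0. Qed.

Lemma snd_le_enorm v : `|v.2| <= enorm v.
Proof. by rewrite -sqrtr_sqr ler_wsqrtr// lerDr sqr_ge0. Qed.

Lemma enorm_le v : enorm v <= `|v.1| + `|v.2|.
Proof.
rewrite -(ger0_norm (addr_ge0 (normr_ge0 v.1) (normr_ge0 v.2))) -sqrtr_sqr.
rewrite ler_wsqrtr// sqrrD !real_normK ?num_real// -addrA lerD2l lerDr.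
by rewrite mulrn_wge0// mulr_ge0.
Qed.

Lemma lattice_norm_le v k : lattice_norm v <= enorm (v - zplane k).
Proof.
apply: ge_inf; last by exists k.
by exists 0 => _ [j _ <-]; exact: enorm_ge0.
Qed.

Lemma lattice_norm_ge v (c : R) : (forall k, c <= enorm (v - zplane k)) ->
  c <= lattice_norm v.
Proof.
move=> h; apply: lb_le_inf; first by exists (enorm (v - zplane 0)), 0.
by move=> _ [k _ <-]; exact: h.
Qed.

Lemma lattice_normD v k : lattice_norm (v + zplane k) = lattice_norm v.
Proof.
have le (u : plane R) (j : int * int) : lattice_norm (u + zplane j) <= lattice_norm u.
  apply: lattice_norm_ge => i.
  have -> : u - zplane i = u + zplane j - zplane (i + j).
    by rewrite /zplane/= !intrD; congr pair => /=; ring.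
  exact: lattice_norm_le.
apply/le_anti; rewrite le/=.
have {1}-> : v = v + zplane k + zplane (- k).
  by rewrite /zplane/= !mulrNz [LHS]surjective_pairing; congr pair => /=; ring.
exact: le.
Qed.

Lemma exists_nearest_int x : exists m : int,
  `|x - m%:~R| <= 2^-1 /\ forall j : int, `|x - m%:~R| <= `|x - j%:~R|.
Proof.
have := floor_itv (x + 2^-1); set m := Num.floor _; rewrite intrD => /andP[m1 m2].
have mx : `|x - m%:~R| <= 2^-1 by rewrite ler_norml; lra.
exists m; split => // j; have [->//|jm] := eqVneq j m.
have : 1 <= `|m%:~R - j%:~R| :> R.
  by rewrite -intrB -intr_norm ler1z -gtz0_ge1 normr_gt0 subr_eq0 eq_sym.
have := ler_normB (x - j%:~R) (x - m%:~R).
rewrite (_ : x - _ - _ = m%:~R - j%:~R); [lra | ring].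
Qed.

(** Rounding both coordinates to a nearest integer minimises the Euclidean norm
    and leaves a vector in the square of side 1 centred at 0. *)
Lemma lattice_norm_attained v : exists k,
  lattice_norm v = enorm (v - zplane k) /\ enorm (v - zplane k) <= 1.
Proof.
have [m1 [m1h m1min]] := exists_nearest_int v.1.
have [m2 [m2h m2min]] := exists_nearest_int v.2.
exists (m1, m2); split; last by apply: (le_trans (enorm_le _)) => /=; lra.
apply/le_anti; rewrite lattice_norm_le/= lattice_norm_ge// => k.
rewrite /enorm ler_wsqrtr//= lerD//.
  rewrite -[leLHS]real_normK ?num_real// -[leRHS]real_normK ?num_real//.
  by rewrite lerXn2r ?nnegrE.
rewrite -[leLHS]real_normK ?num_real// -[leRHS]real_normK ?num_real//.
by rewrite lerXn2r ?nnegrE.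
Qed.

Lemma torus_dist_proj v w :
  torus_dist (torus_proj v) (torus_proj w) = lattice_norm (v - w).
Proof.
rewrite /torus_dist.
have /torus_projP[i ->] := torus_reprK (torus_proj v).
have /torus_projP[j ->] := torus_reprK (torus_proj w).
rewrite -(lattice_normD (v - w) (i - j)); congr lattice_norm.
by rewrite /zplane/= !intrB; congr pair => /=; ring.
Qed.

Section skew_holder.
Variables (al : R) (H : R -> R).
Hypothesis pH : int_periodic H.

Let f := skew_product al (descend H).

(** At distance at most 1, the linear terms coming from the rotation and from
    the second coordinate are bounded by the a-th power of the distance. *)
Lemma holder_skew (a M : R) : 0 < a <= 1 -> 0 <= M ->
  (forall x y, `|H x - H y| <= M * `|x - y| `^ a) -> holder a f.
Proof.
move=> /andP[a0 a1] M0 hH; exists (2 + M) => z1 z2.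
rewrite -(torus_reprK z1) -(torus_reprK z2) /f !skew_product_proj//.
move: (torus_repr z1) (torus_repr z2) => v w {z1 z2}.
rewrite !torus_dist_proj; have [k [-> e1]] := lattice_norm_attained (v - w).
set e := enorm (v - w - zplane k) in e1 *.
have e_ge0 : 0 <= e by exact: enorm_ge0.
apply: (le_trans (lattice_norm_le _ k)); apply: (le_trans (enorm_le _)) => /=.
have h1 : `|v.1 - w.1 - k.1%:~R| <= e by exact: (fst_le_enorm (v - w - zplane k)).
have h2 : `|v.2 - w.2 - k.2%:~R| <= e by exact: (snd_le_enorm (v - w - zplane k)).
have h3 : `|H v.1 - H w.1| <= M * e `^ a.
  rewrite -(pH w.1 k.1) (le_trans (hH _ _))// ler_wpM2l//.
  by rewrite ge0_ler_powR ?nnegrE ?(ltW a0)// opprD addrA.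
have ea : e <= e `^ a.
  have [->|e0] := eqVneq e 0; first exact: powR_ge0.
  by apply: ger1_powR => //; rewrite e1 lt_neqAle eq_sym e0 e_ge0.
have -> : v.1 + al - (w.1 + al) - k.1%:~R = v.1 - w.1 - k.1%:~R by ring.
have -> : v.2 + H v.1 - (w.2 + H w.1) - k.2%:~R =
  (v.2 - w.2 - k.2%:~R) + (H v.1 - H w.1) by ring.
have := ler_normD (v.2 - w.2 - k.2%:~R) (H v.1 - H w.1); lra.
Qed.

(** The second coordinates of the images of (x, 0) and (0, 0) differ by
    H x - H 0, which for small x is its own distance to the integers. *)
Lemma holder_skew_local (a : R) : continuous H -> 0 <= a -> holder a f ->
  exists M r : R, 0 < r /\
    forall x, `|x| <= r -> `|H x - H 0| <= M * `|x| `^ a.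
Proof.
move=> cH a0 [M hM]; exists `|M|.
have [r r0 hr] : exists2 r : R, 0 < r & forall x, `|x| <= r -> `|H x - H 0| <= 2^-1.
  have /cvgrPdist_le/(_ 2^-1) := cH 0; rewrite invr_gt0 ltr0n => /(_ isT).
  move=> /nbhs_ballP[r /= r0 hr]; exists (r / 2); first by rewrite divr_gt0.
  move=> x xr; rewrite distrC; apply: hr; rewrite /ball/= sub0r normrN.
  by apply: le_lt_trans xr _; lra.
exists r; split => // x xr.
have := hM (torus_proj (x, 0)) (torus_proj (0, 0)).
rewrite /f !skew_product_proj// !torus_dist_proj => h.
apply: (le_trans (y := lattice_norm (skew_lift al H (x, 0) - skew_lift al H (0, 0)))).
  apply: lattice_norm_ge => k; apply: le_trans (snd_le_enorm _) => /=.
  rewrite !add0r; have := hr x xr; set D := H x - H 0 => Dh.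
  have [->|k0] := eqVneq k.2 0; first by rewrite subr0.
  have : 1 <= `|k.2%:~R| :> R by rewrite -intr_norm ler1z -gtz0_ge1 normr_gt0.
  by have := ler_normB D (D - k.2%:~R); rewrite opprB addrC subrK; lra.
apply: (le_trans h).
have nx : lattice_norm ((x, 0) - (0, 0)) <= `|x|.
  apply: (le_trans (lattice_norm_le _ 0)); apply: (le_trans (enorm_le _)) => /=.
  by rewrite !subr0 normr0 addr0.
have nx0 : 0 <= lattice_norm ((x, 0) - (0, 0) : plane R).
  by apply: lattice_norm_ge => k; exact: enorm_ge0.
apply: (le_trans (y := `|M| * lattice_norm ((x, 0) - (0, 0)) `^ a)).
  by rewrite ler_wpM2r ?powR_ge0// ler_norm.
by rewrite ler_wpM2l// ge0_ler_powR.
Qed.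

End skew_holder.
End torus_metric.

(** * Powers and the chord length of the circle *)

Section real_powers.
Context {R : realType}.
Implicit Types a s t : R.

Lemma min1_le_powR a t : 0 <= a <= 1 -> 0 <= t -> Num.min 1 t <= t `^ a.
Proof.
move=> /andP[a0 a1] t0; have [t1|t1] := leP 1 t.
  by rewrite -[leLHS](powRr0 t); apply: ler_powR.
move: t0; rewrite le_eqVlt => /predU1P[<-|t0]; first exact: powR_ge0.
by apply: ger1_powR => //; rewrite t0 ltW.
Qed.

(** Concavity, in the form of Young's inequality for s^a and 1 with exponents
    1/a and 1/(1-a). *)
Lemma powR_le_tangent a s : 0 < a <= 1 -> 0 <= s -> s `^ a <= 1 + a * (s - 1).
Proof.
move=> /andP[a0]; rewrite le_eqVlt => /predU1P[->|a1] s0.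
  by rewrite powRr1//; lra.
have := @conjugate_powR R (s `^ a) 1 a^-1 (1 - a)^-1 (powR_ge0 _ _) ler01.
rewrite !invr_gt0 !invrK a0 subr_gt0 a1 addrC subrK mulr1 -powRrM.
rewrite mulfV ?gt_eqF// powRr1// powR1 => /(_ isT isT erefl) h.
by apply: (le_trans h); lra.
Qed.

Lemma powR_midpoint a s t m : 0 < a <= 1 -> 0 <= s -> 0 <= t -> 0 < m ->
  s + t <= 2 * m -> s `^ a + t `^ a <= 2 * m `^ a.
Proof.
move=> a01 s0 t0 m0 stm.
have tangent x : 0 <= x -> x `^ a <= m `^ a * (1 + a * (x / m - 1)).
  move=> x0; have xm0 : 0 <= x / m by rewrite divr_ge0// ltW.
  rewrite -{1}(mulfVK (lt0r_neq0 m0) x) mulrC powRM ?(ltW m0)//.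
  by rewrite ler_wpM2l ?powR_ge0 ?powR_le_tangent.
apply: (le_trans (lerD (tangent _ s0) (tangent _ t0))).
rewrite -mulrDr mulrC ler_wpM2r ?powR_ge0//.
have: s / m + t / m <= 2 by rewrite -mulrDl ler_pdivrMr.
by case/andP: a01; nra.
Qed.

Lemma powR_subadd a s t : 0 < a <= 1 -> 0 <= s -> 0 <= t ->
  (s + t) `^ a <= s `^ a + t `^ a.
Proof.
move=> a01 s0 t0.
have [->|st0] := eqVneq (s + t) 0.
  by rewrite powR0 ?addr_ge0 ?powR_ge0// gt_eqF//; case/andP: a01.
have {}st0 : 0 < s + t by rewrite lt_neqAle eq_sym st0 addr_ge0.
have part x : 0 <= x <= s + t -> (s + t) `^ a * (x / (s + t)) <= x `^ a.
  move=> /andP[]; rewrite le_eqVlt => /predU1P[<-|x0 xst].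
    by rewrite mul0r mulr0 powR_ge0.
  have xst0 : 0 <= x / (s + t) by rewrite divr_ge0 ?(ltW x0) ?ltW.
  rewrite -{2}(mulfVK (lt0r_neq0 st0) x) [in leRHS]mulrC powRM ?(ltW st0)//.
  rewrite ler_wpM2l ?powR_ge0// ger1_powR//; last by case/andP: a01.
  by rewrite divr_gt0// ler_pdivrMr// mul1r.
apply: le_trans (lerD (part s _) (part t _)); rewrite ?s0 ?t0 ?lerDl ?lerDr//.
by rewrite -mulrDr -mulrDl divff ?mulr1// gt_eqF.
Qed.

Lemma dist_powR_le a s t : 0 < a <= 1 -> 0 <= s -> 0 <= t ->
  `|s `^ a - t `^ a| <= `|s - t| `^ a.
Proof.
move=> a01; wlog ts : s t / t <= s => [hw s0 t0|s0 t0].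
  have [/hw|/ltW/hw] := leP t s; first exact.
  by rewrite distrC (distrC s); apply.
have a0 : 0 <= a by case/andP: a01 => /ltW.
rewrite !ger0_norm ?subr_ge0 ?ge0_ler_powR ?nnegrE//.
rewrite lerBlDr -{1}(subrK t s); apply: powR_subadd => //.
by rewrite subr_ge0.
Qed.

End real_powers.

Section trigonometry.
Context {R : realType}.
Implicit Types (x y t : R) (m : int) (n : nat).

Lemma norm_sin_le x : `|sin x| <= `|x|.
Proof.
wlog x0 : x / 0 <= x => [hw|].
  have [/hw//|/ltW] := leP 0 x; rewrite -oppr_ge0 => /hw.
  by rewrite sinN !normrN.
have [c _] := @MVT_segment R sin cos 0 x x0 (fun x _ => is_derive_sin x)
  (continuous_subspaceT (@continuous_sin R)).
rewrite sin0 !subr0 => ->; rewrite normrM.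
by rewrite ler_piMl// cos_max.
Qed.

Lemma cos_intD x m : cos (2 * pi * (x + m%:~R)) = cos (2 * pi * x).
Proof.
have natD y n : cos (2 * pi * (y + n%:R)) = cos (2 * pi * y).
  by rewrite mulrDr mulr_natr mulr_natl (periodicn (@cosD2pi R)).
case: m => n; first exact: natD.
by rewrite -(natD (x + _) n.+1) NegzE mulrNz pmulrn subrK.
Qed.

Lemma cos_le0 x : pi / 2 <= x <= pi -> cos x <= 0.
Proof.
move=> /andP[x1 x2]; rewrite -oppr_ge0 -sinBpihalf sin_ge0_pi//.
by rewrite subr_ge0 x1/=; have := @pi_gt0 R; lra.
Qed.

Lemma cos_sub_cos x t : cos x - cos (x + 2 * t) = 2 * sin t * sin (x + t).
Proof.
have -> : cos x = cos (x + t - t) by congr cos; ring.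
have -> : cos (x + 2 * t) = cos (x + t + t) by congr cos; ring.
by rewrite cosB (cosD (x + t)); ring.
Qed.

Lemma sin_sub_sin x y :
  sin x - sin y = 2 * sin ((x - y) / 2) * cos ((x + y) / 2).
Proof.
have -> : sin x = sin ((x + y) / 2 + (x - y) / 2) by congr sin; field.
have -> : sin y = sin ((x + y) / 2 - (x - y) / 2) by congr sin; field.
by rewrite sinD sinB; ring.
Qed.

Lemma dist_sin_le x y : `|sin x - sin y| <= 2 * Num.min 1 `|x - y|.
Proof.
rewrite sin_sub_sin -mulrA normrM ger0_norm// ler_wpM2l//.
rewrite (le_trans (y := `|sin ((x - y) / 2)|)) //.
  by rewrite normrM ler_piMr ?cos_max.
rewrite le_min sin_max/=; apply: (le_trans (norm_sin_le _)).
rewrite normrM ler_piMr// ger0_norm; lra.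
Qed.

(** Half the Euclidean distance from exp(2 i pi x) to 1: a translation-invariant
    metric on the circle in which triangle inequality and periodicity are
    trigonometric identities. *)
Definition chord x := `|sin (pi * x)|.

Lemma chord_ge0 x : 0 <= chord x. Proof. exact: normr_ge0. Qed.

Lemma chord_le1 x : chord x <= 1. Proof. exact: sin_max. Qed.

Lemma chord0 : chord 0 = 0. Proof. by rewrite /chord mulr0 sin0 normr0. Qed.

Lemma chordN x : chord (- x) = chord x.
Proof. by rewrite /chord mulrN sinN normrN. Qed.

Lemma chord_intD x m : chord (x + m%:~R) = chord x.
Proof.
rewrite /chord.
have natD y n : `|sin (pi * (y + n%:R))| = `|sin (pi * y)|.
  rewrite mulrDr mulr_natr (alternatingn (@sinDpi R)).
  by rewrite normrM normrX normrN1 expr1n mul1r.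
case: m => n; first exact: natD.
by rewrite -(natD (x + _) n.+1) NegzE mulrNz pmulrn subrK.
Qed.

Lemma chord_le x : chord x <= pi * `|x|.
Proof.
by rewrite (le_trans (norm_sin_le _))// normrM ger0_norm ?pi_ge0.
Qed.

Lemma chord_subadd x y : chord (x + y) <= chord x + chord y.
Proof.
rewrite /chord mulrDr sinD (le_trans (ler_normD _ _))// !normrM.
by apply: lerD; [rewrite ler_piMr ?cos_max | rewrite ler_piMl ?cos_max].
Qed.

Lemma chord_natM n x : chord (n%:R * x) <= n%:R * chord x.
Proof.
elim: n => [|n ih]; first by rewrite !mul0r chord0.
rewrite -natr1 !mulrDl !mul1r (le_trans (chord_subadd _ _))//.
by rewrite lerD2r.
Qed.

Lemma dist_chord_le x y : `|chord x - chord y| <= chord (x - y).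
Proof.
have le u v : chord u - chord v <= chord (u - v).
  by rewrite lerBlDr -{1}(subrK v u); exact: chord_subadd.
by rewrite ler_norml le andbT lerNl opprB -(chordN (x - y)) opprB le.
Qed.

(** The two sines at y + x and y - x have sum and difference bounded by
    2 |sin(pi y)| and 2 |sin(pi x)|, and the sum of their absolute values is one
    of these two up to sign. *)
Lemma chord_second_difference x y :
  chord x <= chord y -> chord (y + x) + chord (y - x) <= 2 * chord y.
Proof.
rewrite /chord => xy.
have add : `|sin (pi * (y + x)) + sin (pi * (y - x))| <= 2 * `|sin (pi * y)|.
  rewrite mulrDr mulrBr sinD sinB.
  rewrite [X in `|X|](_ : _ = 2 * (sin (pi * y) * cos (pi * x))); last by ring.
  by rewrite !normrM (ger0_norm (ler0n R 2)) ler_wpM2l// ler_piMr ?cos_max.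
have sub : `|sin (pi * (y + x)) - sin (pi * (y - x))| <= 2 * `|sin (pi * y)|.
  rewrite mulrDr mulrBr sinD sinB.
  rewrite [X in `|X|](_ : _ = 2 * (cos (pi * y) * sin (pi * x))); last by ring.
  rewrite !normrM (ger0_norm (ler0n R 2)) ler_wpM2l//.
  by rewrite (le_trans _ xy)// ler_piMl ?cos_max.
move: add sub; rewrite !ler_norml => /andP[? ?] /andP[? ?].
by case: (ger0P (sin (pi * (y + x)))) => ?;
  case: (ger0P (sin (pi * (y - x)))) => ?; lra.
Qed.

Lemma chord_half : chord 2^-1 = 1.
Proof. by rewrite /chord sin_pihalf normr1. Qed.

Lemma chord_gt0_irrational x : irrational x -> 0 < chord x.
Proof.
move=> irr; rewrite /chord normr_gt0; apply/eqP => s0; apply: irr.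
have fl : 0 <= x - (Num.floor x)%:~R < 1.
  by have := floor_itv x; rewrite intrD; lra.
have {}s0 : chord (x - (Num.floor x)%:~R) = 0.
  by rewrite -mulrNz chord_intD /chord s0 normr0.
have [x0|] := eqVneq (x - (Num.floor x)%:~R) 0.
  have /eqP := x0; rewrite subr_eq0 => /eqP ->.
  by exists (Num.floor x)%:~R => //=; rewrite ratr_int.
move=> ne; have /normr0_eq0 sin0 := s0; have pi0 := @pi_gt0 R.
have : 0 < sin (pi * (x - (Num.floor x)%:~R)); last by rewrite sin0 ltxx.
have y0 : 0 < x - (Num.floor x)%:~R by rewrite lt_neqAle eq_sym ne; case/andP: fl.
by apply: sin_gt0_pi; rewrite mulr_gt0//= gtr_pMr//; case/andP: fl.
Qed.

End trigonometry.

(** * Rational approximations and geometrically dominated series *)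

Section dominated_series.
Context {R : realType}.
Implicit Types (u v : nat -> R) (c : R) (k : nat).

Definition wt k : R := (2 ^+ k.+1)^-1.

Lemma wt_gt0 k : 0 < wt k. Proof. by rewrite invr_gt0 exprn_gt0. Qed.

Lemma wt_lt1 k : wt k < 1.
Proof. by rewrite invf_lt1 ?exprn_gt0// exprn_egt1// ltr1n. Qed.

Lemma cvg_series_wt c : series (fun k => c * wt k) @ \oo --> c.
Proof.
have := cvg_geometric_series_half c 0; rewrite expr0 divr1.
rewrite (_ : (fun k => _) = fun k => c * wt k)//.
by apply/funext => k; rewrite /wt addn1 natrX.
Qed.

Definition geo_dominated u c := forall k, `|u k| <= c * wt k.

Lemma geo_dominated_cvg u c : geo_dominated u c -> cvgn (series u).
Proof.
move=> uc; apply: normed_cvg.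
apply: (@series_le_cvg _ _ (fun k => c * wt k)) => //.
- by move=> k; exact: normr_ge0.
- by move=> k; exact: le_trans (normr_ge0 _) (uc k).
- by apply/cvg_ex; exists c; exact: cvg_series_wt.
Qed.

Lemma geo_dominated_lim_le u c : geo_dominated u c -> `|limn (series u)| <= c.
Proof.
move=> uc; have cw : cvgn (series (fun k => c * wt k)).
  by apply/cvg_ex; exists c; exact: cvg_series_wt.
have limw : limn (series (fun k => c * wt k)) = c.
  by apply/cvg_lim => //; exact: cvg_series_wt.
have cu := geo_dominated_cvg _ _ uc.
rewrite ler_norml -[X in - X <= _]limw -{2}limw -lim_seriesN//.
apply/andP; split; apply: lim_series_le => //; rewrite ?is_cvg_seriesN//.
  by move=> k; have := uc k; rewrite ler_norml => /andP[].
by move=> k; have := uc k; rewrite ler_norml => /andP[].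
Qed.

Lemma lim_series_ge_term u k : cvgn (series u) -> (forall j, 0 <= u j) ->
  u k <= limn (series u).
Proof.
move=> cu u0; apply: (le_trans (y := series u k.+1)).
  by rewrite seriesS lerDl sumr_ge0.
apply: nondecreasing_cvgn_le => //.
exact: nondecreasing_series.
Qed.

End dominated_series.

Arguments geo_dominated_cvg {R u c}.
Arguments geo_dominated_lim_le {R u c}.

Section approximation.
Context {R : realType}.
Implicit Types (al a de : R) (pq : int * nat).

Definition offset al pq : R := pq.2%:R * al - pq.1%:~R.

Lemma finite_bounded_denominators al n :
  finite_set [set pq | (pq.2 <= n)%N /\ `|offset al pq| <= 1].
Proof.
have [m hm] : exists m : nat, n%:R * `|al| + 1 < m%:R.
  exists (Num.truncn (n%:R * `|al| + 1)).+1; exact: truncnS_gt.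
pose f (jk : bool * nat * nat) : int * nat :=
  ((if jk.1.1 then Posz jk.1.2 else - Posz jk.1.2), jk.2).
have : finite_set (f @` (([set: bool] `*` `I_m) `*` `I_n.+1)).
  apply: finite_image; do 2?apply: finite_setX; try exact: finite_II.
  exact: finite_finset.
apply: sub_finite_set => -[p q] [/= qn off].
have pm : (`|p| < m)%N.
  rewrite -(ltr_nat R); apply: le_lt_trans hm.
  rewrite natr_absz intr_norm.
  have -> : p%:~R = q%:R * al - offset al (p, q) by rewrite /offset/=; ring.
  rewrite (le_trans (ler_normB _ _))// lerD// normrM normr_nat.
  by rewrite ler_wpM2r// ler_nat.
exists (0 <= p, `|p|%N, q); first by [].
rewrite /f/=; congr pair; have [p0|p0] := leP 0 p.
  by rewrite gez0_abs.
by rewrite ltz0_abs// opprK.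
Qed.

(** A real r with 1 + a/(1-de) < r gives infinitely many p/q with
    |q al - p| < q^(1-r); then (r-1)(1-de) >= a.  Only finitely many of these
    fractions have a bounded denominator, and a large denominator makes
    q^(1-r) <= tau. *)
Lemma exists_good_approximation al a de : 0 < a -> de < 1 -> irrational al ->
  ((1 + a / (1 - de))%:E < irrationality_measure al)%E ->
  forall tau, 0 < tau -> exists pq,
    0 < `|offset al pq| <= tau /\
    `|offset al pq| `^ (1 - de) * pq.2%:R `^ a <= 1.
Proof.
move=> a0 de1 irr /ereal_sup_gt[_ [r [r0 inf] <-]]; rewrite lte_fin => ar tau tau0.
have de0 : 0 < 1 - de by rewrite subr_gt0.
have s0 : 0 < r - 1.
  rewrite subr_gt0; apply: lt_trans ar.
  by rewrite ltrDl divr_gt0.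
pose n := (Num.truncn (tau `^ (- (r - 1)^-1))).+1.
have := infinite_setD inf (finite_bounded_denominators al n).
move=> /infinite_setN0[[p q]] [[/= q0 cpq apx]] big.
have q0' : 0 < q%:R :> R by rewrite ltr0n.
have qn0 : q%:R != 0 :> R by rewrite gt_eqF.
have off : `|offset al (p, q)| < q%:R `^ (- (r - 1)).
  have -> : offset al (p, q) = q%:R * (al - p%:~R / q%:R).
    by rewrite /offset/=; field; rewrite gt_eqF.
  rewrite normrM normr_nat opprB powRD ?qn0 ?implybT// powRr1 ?ler0n//.
  by rewrite ltr_pM2l.
have qr1 : q%:R `^ (- (r - 1)) <= 1 :> R.
  rewrite -[leRHS](powRr0 q%:R); apply: ler_powR; first by rewrite ler1n.
  by rewrite oppr_le0 ltW.
have nq : (n < q)%N.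
  rewrite ltnNge; apply/negP => qn; apply: big; split => //=.
  exact: le_trans (ltW off) qr1.
exists (p, q); split; first (apply/andP; split).
- rewrite normr_gt0; apply/eqP => /= z; apply: irr.
  exists (p%:~R / q%:R) => //; rewrite fmorph_div/= ratr_int ratr_nat.
  have -> : p%:~R = q%:R * al by move: z; rewrite /offset/=; lra.
  by rewrite mulrC mulKf// gt_eqF.
- apply: (le_trans (ltW off)); rewrite powRN.
  rewrite invf_ple ?posrE ?powR_gt0//.
  have tn : tau `^ (- (r - 1)^-1) < q%:R.
    apply: lt_trans (truncnS_gt _) _; by rewrite ltr_nat.
  have := ge0_ler_powR (ltW s0) _ _ (ltW tn).
  rewrite !nnegrE powR_ge0 ler0n => /(_ isT isT); apply: le_trans.
  by rewrite -powRrM mulNr mulVf ?gt_eqF// powR_inv1// ltW.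
- have h := ge0_ler_powR (ltW de0) _ _ (ltW off).
  rewrite !nnegrE normr_ge0 powR_ge0 in h.
  have {h} := h isT isT => h.
  apply: (le_trans (ler_wpM2r (powR_ge0 _ _) h)).
  rewrite -powRrM -powRD ?qn0 ?implybT//.
  rewrite -[leRHS](powRr0 q%:R); apply: ler_powR; first by rewrite ler1n.
  have : a <= (r - 1) * (1 - de) by rewrite -ler_pdivrMr// lerBrDl ltW.
  by rewrite mulNr /=; lra.
Qed.

End approximation.

(** * The forcing function *)

Section forcing.
Context {R : realType}.
Variables (al a de ka et : R) (pq : nat -> int * nat).
Hypothesis a01 : 0 < a <= 1.
Hypothesis de01 : 0 <= de < 1.
Hypothesis ka_gt0 : 0 < ka.
Hypothesis et_gt0 : 0 < et.
Hypothesis chord_al : 0 < chord al.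
(* (wt k)^k decays faster than any fixed power of wt k. *)
Hypothesis offset_small : forall k, 0 < `|offset al (pq k)| <= wt k ^+ k.
Hypothesis good : forall k,
  `|offset al (pq k)| `^ (1 - de) * (pq k).2%:R `^ a <= 1.

Local Notation q k := ((pq k).2%:R : R).
Local Notation beta k := `|offset al (pq k)|.
Implicit Types (x t : R) (k n : nat).

Let a_ge0 : 0 <= a <= 1. Proof. by case/andP: a01 => /ltW ->. Qed.
Let de_ge0 : 0 <= de <= 1. Proof. by case/andP: de01 => -> /ltW. Qed.

Let beta_gt0 k : 0 < beta k.
Proof. by case/andP: (offset_small k). Qed.

Definition amplitude k : R := ka * wt k * beta k `^ (- de).

Lemma amplitude_ge0 k : 0 <= amplitude k.
Proof.
by rewrite mulr_ge0 ?powR_ge0// mulr_ge0 ?(ltW (wt_gt0 k))// ltW.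
Qed.

Let amplitude2_ge0 k : 0 <= 2 * amplitude k.
Proof. by rewrite mulr_ge0// amplitude_ge0. Qed.

(** V (x + t) - V x for V x = amplitude k * (1 - cos (2 pi q_k x)). *)
Definition wave_diff x t k : R :=
  amplitude k * (cos (2 * pi * (q k * x)) - cos (2 * pi * (q k * (x + t)))).

Lemma wave_diffE x t k : wave_diff x t k =
  2 * amplitude k * (sin (pi * (q k * t)) * sin (pi * (q k * (2 * x + t)))).
Proof.
rewrite /wave_diff.
have -> : 2 * pi * (q k * (x + t)) = 2 * pi * (q k * x) + 2 * (pi * (q k * t)).
  by ring.
rewrite cos_sub_cos.
have -> : pi * (q k * (2 * x + t)) = 2 * pi * (q k * x) + pi * (q k * t) by ring.
by ring.
Qed.

Lemma denominator_rotation n k :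
  q k * (n%:R * al) = n%:R * offset al (pq k) + (n%:Z * (pq k).1)%:~R.
Proof. by rewrite /offset intrM -pmulrn; ring. Qed.

(** q_k n al is n (q_k al - p_k) modulo 1; then apply min(1, t) <= t^de and
    pi^de <= pi. *)
Lemma chord_denominator_rotation n k :
  chord (q k * (n%:R * al)) <= pi * n%:R `^ de * beta k `^ de.
Proof.
rewrite denominator_rotation chord_intD -mulrA -powRM ?ler0n//.
apply: (le_trans (y := pi `^ de * (n%:R * beta k) `^ de)).
  rewrite -powRM ?pi_ge0 ?mulr_ge0//.
  apply: (le_trans _ (min1_le_powR _ _ de_ge0 _)); last first.
    by rewrite !mulr_ge0 ?pi_ge0.
  rewrite le_min chord_le1 (le_trans (chord_le _))//.
  by rewrite normrM normr_nat.
rewrite ler_wpM2r ?powR_ge0//; apply: ler1_powR; last by case/andP: de_ge0.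
by have := @pi_ge2 R; lra.
Qed.

(** The factor beta_k^-de of the amplitude cancels the beta_k^de of
    [chord_denominator_rotation]. *)
Lemma wave_diff_dominated n x :
  geo_dominated (wave_diff x (n%:R * al)) (2 * pi * ka * n%:R `^ de).
Proof.
move=> k; rewrite wave_diffE normrM ger0_norm//.
rewrite normrM -/(chord _).
apply: (le_trans (y := 2 * amplitude k * (pi * n%:R `^ de * beta k `^ de))).
  rewrite ler_wpM2l//.
  apply: (le_trans _ (chord_denominator_rotation _ _)).
  by rewrite ler_piMr ?chord_ge0 ?sin_max.
rewrite /amplitude powRN.
have b0 : beta k `^ de != 0 by rewrite gt_eqF ?powR_gt0.
by rewrite le_eqVlt; apply/orP; left; apply/eqP; field.
Qed.

Lemma is_cvg_wave_diff n x : cvgn (series (wave_diff x (n%:R * al))).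
Proof. exact: (geo_dominated_cvg (wave_diff_dominated n x)). Qed.

(** The difference V (x + t) - V x of the formal primitive; the series converges
    when t is a natural multiple of al. *)
Definition cocycle x t : R :=
  et * (chord (x + t) `^ a - chord x `^ a) + limn (series (wave_diff x t)).

Definition forcing x : R := cocycle x al.

Lemma cocycle0 x : cocycle x (0%:R * al) = 0.
Proof.
rewrite /cocycle mul0r addr0 subrr mulr0 add0r.
rewrite (_ : wave_diff x 0 = cst 0); last first.
  by apply/funext => k; rewrite /wave_diff addr0 subrr mulr0.
rewrite (_ : series _ = cst 0) ?lim_cst//.
by apply/funext => n; rewrite /series/= big1.
Qed.

Lemma cocycleS x n :
  cocycle x (n.+1%:R * al) = cocycle x (n%:R * al) + forcing (x + n%:R * al).
Proof.
have -> : n.+1%:R * al = n%:R * al + al by rewrite -natr1 mulrDl mul1r.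
have c1 := is_cvg_wave_diff 1 (x + n%:R * al); rewrite mul1r in c1.
rewrite /forcing /cocycle.
have -> : wave_diff x (n%:R * al + al) =
    wave_diff x (n%:R * al) + wave_diff (x + n%:R * al) al.
  by apply/funext => k; rewrite fctE /wave_diff (addrA x (n%:R * al)); ring.
rewrite lim_seriesD//; last exact: is_cvg_wave_diff.
by rewrite (addrA x (n%:R * al)); ring.
Qed.

Lemma birkhoff_sum_forcing x n :
  birkhoff_sum al forcing n x = cocycle x (n%:R * al).
Proof.
rewrite /birkhoff_sum.
elim: n => [|n ih]; first by rewrite big_ord0 cocycle0.
by rewrite big_ord_recr/= ih cocycleS.
Qed.

Lemma norm_cocycle_le x n :
  `|cocycle x (n%:R * al)| <= et + 2 * pi * ka * n%:R `^ de.
Proof.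
rewrite (le_trans (ler_normD _ _))// lerD//; last first.
  exact: (geo_dominated_lim_le (wave_diff_dominated n x)).
rewrite normrM gtr0_norm// ler_piMr ?(ltW et_gt0)//.
have cusp01 y : 0 <= chord y `^ a <= 1.
  have one : 1 `^ a = 1 :> R by rewrite powR1.
  rewrite powR_ge0/= -[leRHS]one.
  by rewrite ge0_ler_powR ?nnegrE ?chord_ge0 ?chord_le1//; case/andP: a_ge0.
by rewrite ler_norml; have := cusp01 x; have := cusp01 (x + n%:R * al); lra.
Qed.

(** All terms of the formal primitive are nonnegative and vanish at 0. *)
Lemma cocycle_at0_ge n k :
  amplitude k * (1 - cos (2 * pi * (q k * (n%:R * al)))) <= cocycle 0 (n%:R * al).
Proof.
rewrite /cocycle add0r chord0 powR0 ?subr0; last by case/andP: a01 => /gt_eqF ->.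
rewrite -[leLHS]add0r lerD ?mulr_ge0 ?powR_ge0 ?(ltW et_gt0)//.
have wE j : wave_diff 0 (n%:R * al) j =
    amplitude j * (1 - cos (2 * pi * (q j * (n%:R * al)))).
  by rewrite /wave_diff add0r !mulr0 cos0.
rewrite -wE lim_series_ge_term//; first exact: is_cvg_wave_diff.
by move=> j; rewrite wE (mulr_ge0 (amplitude_ge0 _))// subr_ge0 cos_le1.
Qed.

Lemma forcing_periodic : int_periodic forcing.
Proof.
move=> x m.
rewrite /forcing /cocycle addrAC !chord_intD; congr (_ + limn (series _)).
apply/funext => k; rewrite /wave_diff addrAC.
have qm y : q k * (y + m%:~R) = q k * y + ((pq k).2%:Z * m)%:~R.
  by rewrite intrM -pmulrn mulrDr.
by rewrite !qm !cos_intD.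
Qed.

(** In each wave, sin(pi q_k al) contributes a factor of order beta_k, and a wave of
    frequency q_k has a-Hoelder constant of order q_k^a; the product with the
    amplitude is at most a constant times wt k by the choice of the
    approximations. *)
Lemma forcing_holder :
  exists M, 0 <= M /\ forall x y, `|forcing x - forcing y| <= M * `|x - y| `^ a.
Proof.
(* 2 pi q_k is the Lipschitz constant of sin(2 pi q_k x). *)
pose D := (2 * pi) `^ a : R; have D0 : 0 <= D by exact: powR_ge0.
exists (2 * et * D + 4 * pi * ka * D); split.
  by rewrite addr_ge0// !mulr_ge0 ?pi_ge0// ltW.
move=> x y.
have cw z : cvgn (series (wave_diff z al)).
  by have := is_cvg_wave_diff 1 z; rewrite mul1r.
have -> : forcing x - forcing y =
    et * (chord (x + al) `^ a - chord (y + al) `^ a) -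
    et * (chord x `^ a - chord y `^ a) +
    limn (series (wave_diff x al - wave_diff y al)).
  by rewrite lim_seriesB// /forcing /cocycle; ring.
rewrite mulrDl; apply: (le_trans (ler_normD _ _)); apply: lerD.
  have cusp u v : `|et * (chord u `^ a - chord v `^ a)| <= et * D * `|u - v| `^ a.
    rewrite normrM (gtr0_norm et_gt0) -mulrA ler_wpM2l ?(ltW et_gt0)//.
    apply: (le_trans (dist_powR_le _ _ _ a01 (chord_ge0 _) (chord_ge0 _))).
    rewrite -powRM ?mulr_ge0 ?pi_ge0// ge0_ler_powR ?nnegrE ?mulr_ge0 ?pi_ge0//.
      by case/andP: a_ge0.
    apply: (le_trans (dist_chord_le _ _)); apply: (le_trans (chord_le _)).
    by rewrite ler_wpM2r// ler_peMl ?pi_ge0// ler1n.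
  apply: (le_trans (ler_normB _ _)).
  have := cusp x y; have := cusp (x + al) (y + al).
  by rewrite (_ : x + al - (y + al) = x - y); [lra | ring].
apply: geo_dominated_lim_le => k.
have -> : (wave_diff x al - wave_diff y al) k =
    wave_diff x al k - wave_diff y al k by [].
rewrite !wave_diffE -mulrBr -mulrBr normrM ger0_norm//.
rewrite normrM -/(chord _).
have chordq : chord (q k * al) <= pi * beta k.
  have := denominator_rotation 1 k; rewrite !mul1r => ->.
  by rewrite chord_intD chord_le.
set E := (X in _ * (_ * X)).
have Eb : E <= 2 * (D * q k `^ a * `|x - y| `^ a).
  rewrite /E; apply: (le_trans (dist_sin_le _ _)); rewrite ler_wpM2l//.
  rewrite -!powRM ?mulr_ge0 ?pi_ge0//.
  rewrite (_ : _ - _ = 2 * pi * q k * (x - y)); last by ring.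
  rewrite normrM (ger0_norm (x := 2 * pi * q k)) ?mulr_ge0 ?pi_ge0//.
  by rewrite min1_le_powR ?mulr_ge0 ?pi_ge0.
apply: (le_trans (y := 2 * amplitude k *
    (pi * beta k * (2 * (D * q k `^ a * `|x - y| `^ a))))).
  by rewrite ler_wpM2l// ler_pM ?chord_ge0 ?normr_ge0.
have -> : 2 * amplitude k * (pi * beta k * (2 * (D * q k `^ a * `|x - y| `^ a))) =
    4 * pi * ka * D * `|x - y| `^ a * wt k * (beta k `^ (1 - de) * q k `^ a).
  rewrite powRD ?(gt_eqF (beta_gt0 k)) ?implybT// powRr1 ?normr_ge0//.
  by rewrite /amplitude; ring.
rewrite ler_piMr ?good// !mulr_ge0 ?pi_ge0 ?powR_ge0 ?(ltW ka_gt0)//.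
exact: ltW (wt_gt0 k).
Qed.

Lemma forcing_continuous : continuous forcing.
Proof.
have [M [M0 hM]] := forcing_holder; have a0 : 0 < a by case/andP: a01.
move=> x; apply/cvgrPdist_le => e e0.
have M1 : 0 < M + 1 by lra.
pose r := (e / (M + 1)) `^ a^-1.
have r0 : 0 < r by rewrite powR_gt0 ?divr_gt0.
near=> y; apply: (le_trans (hM x y)).
have : `|x - y| <= r by near: y; exact: cvgr_dist_le.
move=> /(ge0_ler_powR (ltW a0) _ _); rewrite !nnegrE normr_ge0 (ltW r0).
move=> /(_ isT isT); rewrite -powRrM mulVf ?gt_eqF// powRr1; last first.
  by rewrite divr_ge0 ?(ltW e0) ?(ltW M1).
move=> h; apply: (le_trans (ler_wpM2l M0 h)).
rewrite mulrCA ler_piMr ?(ltW e0)// ler_pdivrMr// mul1r; lra.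
Unshelve. all: by end_near. Qed.

(** With X = 2 pi q_k x and A = 2 pi q_k al, the second difference of the k-th
    wave is -2 amplitude_k (1 - cos X)(1 - cos A), and concavity of the a-th
    power makes the one of chord^a at al nonpositive: only the cusp at 0 remains. *)
Lemma forcing_second_difference x : chord x <= chord al ->
  forcing x + forcing (- x) - 2 * forcing 0 <= - (2 * et * chord x `^ a).
Proof.
move=> xal.
have cw z : cvgn (series (wave_diff z al)).
  by have := is_cvg_wave_diff 1 z; rewrite mul1r.
have u0 : chord 0 `^ a = 0 :> R.
  by rewrite chord0 powR0//; case/andP: a01 => /gt_eqF ->.
have cs : cvgn (series (wave_diff x al + wave_diff (- x) al)).
  exact: is_cvg_seriesD.
have c0 : cvgn (series (wave_diff 0 al + wave_diff 0 al)).
  exact: is_cvg_seriesD.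
have -> : forcing x + forcing (- x) - 2 * forcing 0 =
    et * (chord (al + x) `^ a + chord (al - x) `^ a - 2 * chord al `^ a) -
    2 * et * chord x `^ a +
    limn (series (wave_diff x al + wave_diff (- x) al -
                  (wave_diff 0 al + wave_diff 0 al))).
  rewrite lim_seriesB// !lim_seriesD//.
  by rewrite /forcing /cocycle chordN u0 add0r (addrC x) (addrC (- x)); ring.
have waves : limn (series (wave_diff x al + wave_diff (- x) al -
    (wave_diff 0 al + wave_diff 0 al))) <= 0.
  apply: limr_le; first exact: is_cvg_seriesB.
  near=> n; rewrite /series/= sumr_le0// => k _.
  rewrite !fctE /wave_diff.
  have -> : 2 * pi * (q k * (x + al)) = 2 * pi * (q k * x) + 2 * pi * (q k * al).
    by ring.
  have -> : 2 * pi * (q k * (- x + al)) = - (2 * pi * (q k * x) - 2 * pi * (q k * al)).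
    by ring.
  rewrite mulrN mulrN !cosN cosD cosB add0r !mulr0 cos0.
  set X := 2 * pi * (q k * x); set A := 2 * pi * (q k * al).
  rewrite -!mulrDr -!mulrBr (mulr_ge0_le0 (amplitude_ge0 _))//.
  have cX : 0 <= 1 - cos X by rewrite subr_ge0 cos_le1.
  have cA : 0 <= 1 - cos A by rewrite subr_ge0 cos_le1.
  by nra.
have cusps : chord (al + x) `^ a + chord (al - x) `^ a <= 2 * chord al `^ a.
  by rewrite powR_midpoint ?chord_ge0// chord_second_difference.
have : et * (chord (al + x) `^ a + chord (al - x) `^ a - 2 * chord al `^ a) <= 0.
  by rewrite mulr_ge0_le0 ?(ltW et_gt0)// subr_le0.
lra.
Unshelve. all: by end_near. Qed.

(** At x = 1/(2n), subadditivity of [chord] gives chord x >= 1/n, so that the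
    second difference is at least 2 et n^-a in absolute value. *)
Lemma forcing_not_holder a' M r : a < a' -> 0 < r ->
  ~ (forall x, `|x| <= r -> `|forcing x - forcing 0| <= M * `|x| `^ a').
Proof.
move=> aa' r0 hM.
have d0 : 0 < a' - a by rewrite subr_gt0.
have a'0 : 0 <= a' by case/andP: a01 => /ltW a0 _; lra.
(* The three summands ensure x <= r, chord x <= chord al and the final
   contradiction |M| < et n^(a'-a). *)
pose B := r^-1 + pi / chord al + (`|M| / et) `^ (a' - a)^-1.
pose n := (Num.truncn B).+1.
have Bn : B < n%:R by exact: truncnS_gt.
have n0 : 0 < n%:R :> R by rewrite ltr0n.
have B1 : 0 < r^-1 by rewrite invr_gt0.
have B2 : 0 < pi / chord al by rewrite divr_gt0 ?pi_gt0.
have B3 : 0 <= (`|M| / et) `^ (a' - a)^-1 by exact: powR_ge0.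
pose x : R := (2 * n%:R)^-1.
have x0 : 0 < x by rewrite invr_gt0 mulr_gt0.
have xn : x <= n%:R^-1.
  by rewrite lef_pV2 ?posrE ?mulr_gt0// ler_peMl ?ler1n ?(ltW n0).
have xr : x <= r.
  rewrite (le_trans xn)// invf_ple ?posrE//; apply: ltW; apply: (le_lt_trans _ Bn).
  by rewrite /B -addrA lerDl; lra.
have chordx_le : chord x <= chord al.
  rewrite (le_trans (chord_le _))// (gtr0_norm x0).
  apply: (le_trans (y := pi * n%:R^-1)); first by rewrite ler_wpM2l ?pi_ge0.
  rewrite ler_pdivrMr// mulrC -ler_pdivrMr//; apply: ltW; apply: (le_lt_trans _ Bn).
  by rewrite /B; lra.
have chordx_ge : n%:R^-1 <= chord x.
  have := chord_natM n x; rewrite (_ : n%:R * x = 2^-1); last first.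
    by rewrite /x; field; rewrite gt_eqF.
  by rewrite chord_half mulrC -ler_pdivrMr// div1r.
have up : `|forcing x - forcing 0| <= M * x `^ a'.
  by have := hM x; rewrite (gtr0_norm x0) => /(_ xr).
have down : `|forcing (- x) - forcing 0| <= M * x `^ a'.
  by have := hM (- x); rewrite normrN (gtr0_norm x0) => /(_ xr).
have := forcing_second_difference x chordx_le.
move: up down; rewrite !ler_norml => /andP[up _] /andP[down _] sd.
have {up down sd} main : et * chord x `^ a <= M * x `^ a' by lra.
have lhs : et * n%:R^-1 `^ a <= et * chord x `^ a.
  rewrite ler_wpM2l ?(ltW et_gt0)// ge0_ler_powR ?nnegrE ?invr_ge0 ?chord_ge0 ?ler0n//.
  by case/andP: a_ge0.
have rhs : M * x `^ a' <= `|M| * n%:R^-1 `^ a'.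
  apply: (le_trans (y := `|M| * x `^ a')).
    by rewrite ler_wpM2r ?powR_ge0// ler_norm.
  by rewrite ler_wpM2l// ge0_ler_powR ?nnegrE ?invr_ge0 ?mulr_ge0 ?ler0n.
have := le_trans lhs (le_trans main rhs).
rewrite -(subrK a a') powRD; last by rewrite invr_eq0 (gt_eqF n0) implybT.
rewrite mulrA ler_pM2r ?powR_gt0 ?invr_gt0// leNgt => /negP; apply.
have Mn : `|M| / et < n%:R `^ (a' - a).
  have : (`|M| / et) `^ (a' - a)^-1 < n%:R.
    by apply: (le_lt_trans _ Bn); rewrite /B; lra.
  move/(gt0_ltr_powR d0); rewrite !nnegrE powR_ge0 ler0n => /(_ isT isT).
  by rewrite -powRrM mulVf ?gt_eqF// powRr1// divr_ge0// ltW.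
move: Mn; rewrite ltr_pdivrMr//; set N := n%:R : R => Mn.
have -> : N^-1 `^ (a' - a) = (N `^ (a' - a))^-1.
  by rewrite -powR_inv1 ?ler0n// -powRrM mulN1r powRN.
by rewrite ltr_pdivrMr ?powR_gt0// mulrC.
Qed.

(** n is the integer part of 1/(2 beta_k), so that n beta_k lies in
    [1/4, 1/2]. *)
Lemma exists_half_turn k : beta k <= 4^-1 ->
  exists n, [/\ (0 < n)%N, n%:R <= (beta k)^-1 &
    cos (2 * pi * (q k * (n%:R * al))) <= 0].
Proof.
move=> b4; have b0 := beta_gt0 k.
pose n := Num.truncn (2 * beta k)^-1.
have /truncn_itv : 0 <= (2 * beta k)^-1 by rewrite invr_ge0 mulr_ge0.
rewrite -/n => /andP[n1 n2].
have nb1 : n%:R * beta k <= 2^-1.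
  by rewrite -ler_pdivlMr// -invfM.
have nb2 : 4^-1 <= n%:R * beta k.
  move: n2; rewrite -(natr1 n) invfM ltr_pdivrMr// mulrDl mul1r; lra.
have n0 : (0 < n)%N.
  by rewrite lt0n; apply/eqP => z; move: nb2; rewrite z mul0r; lra.
exists n; split => //.
  by rewrite -[leRHS]mul1r ler_pdivlMr//; lra.
rewrite denominator_rotation cos_intD -cos_norm.
rewrite !normrM !normr_nat (ger0_norm (@pi_ge0 R)).
apply: cos_le0; have := @pi_gt0 R; nra.
Qed.

(** At the time n <= 1/beta_k of a half turn of the k-th wave, a bound C' n^de'
    would give ka wt k <= C' beta_k^(de-de').  As beta_k <= (wt k)^k, the right
    side is at most C' (wt k)^2 once k (de-de') >= 2, and wt k tends to 0. *)
Lemma birkhoff_sum_unbounded C' de' : de' < de -> 0 <= de' ->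
  ~ (forall n, (0 < n)%N -> cocycle 0 (n%:R * al) <= C' * n%:R `^ de').
Proof.
move=> dd' de'0 hC; pose e := de - de'; have e0 : 0 < e by rewrite subr_gt0.
have C0 : 0 <= C'.
  have := hC 1%N isT; rewrite powR1 mulr1; apply: le_trans.
  apply: (le_trans _ (cocycle_at0_ge 1 0)).
  by rewrite (mulr_ge0 (amplitude_ge0 _))// subr_ge0 cos_le1.
(* k (de-de') >= 2 and C' / ka < k < 2^(k+1). *)
pose k := (Num.truncn (2 / e) + Num.truncn (C' / ka)).+1.
have ke : 2 <= k%:R * e.
  rewrite -ler_pdivrMr//; apply: (le_trans (ltW (truncnS_gt _))).
  by rewrite ler_nat ltnS leq_addr.
have kC : C' / ka < k%:R.
  apply: (lt_le_trans (truncnS_gt _)).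
  by rewrite ler_nat ltnS leq_addl.
have w0 := @wt_gt0 R k; have w1 := @wt_lt1 R k.
have b0 := beta_gt0 k.
have bw : beta k <= wt k ^+ k by case/andP: (offset_small k).
have w4 : wt k <= 4^-1 :> R.
  rewrite /wt lef_pV2 ?posrE ?exprn_gt0//.
  rewrite [leLHS](_ : _ = 2 ^+ 2); last by ring.
  by rewrite ler_eXn2l// ltr1n.
have [n [n0 nb cosn]] : exists n, [/\ (0 < n)%N, n%:R <= (beta k)^-1 &
    cos (2 * pi * (q k * (n%:R * al))) <= 0].
  apply: exists_half_turn; apply: (le_trans bw); apply: (le_trans _ w4).
  by rewrite exprS ler_piMr ?(ltW w0)// exprn_ile1 ?ltW.
have h1 : amplitude k <= C' * (beta k) `^ (- de').
  apply: (le_trans (y := C' * n%:R `^ de')).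
    apply: (le_trans _ (hC n n0)).
    apply: le_trans _ (cocycle_at0_ge n k).
    by rewrite ler_peMr ?amplitude_ge0//; lra.
  rewrite ler_wpM2l// powRN -[in leRHS]powR_inv1 ?powR_ge0//.
  rewrite -powRrM mulrN1 -mulN1r powRrM powR_inv1 ?(ltW b0)//.
  by rewrite ge0_ler_powR ?nnegrE ?ler0n ?invr_ge0 ?(ltW b0).
have h2 : ka * wt k <= C' * beta k `^ e.
  have := ler_wpM2r (powR_ge0 (beta k) de) h1.
  rewrite /amplitude -!mulrA -!powRD ?(gt_eqF b0) ?implybT//.
  by rewrite addNr powRr0 mulr1 (addrC (- de')).
have h3 : beta k `^ e <= wt k ^+ 2.
  apply: (le_trans (y := (wt k ^+ k) `^ e)).
    by rewrite ge0_ler_powR ?nnegrE ?exprn_ge0 ?(ltW w0) ?(ltW b0) ?(ltW e0).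
  rewrite -!powR_mulrn ?(ltW w0)// -powRrM.
  by apply: ger_powR => //; rewrite w0 ltW.
have {h2 h3} : ka * wt k <= C' * wt k * wt k.
  by rewrite -mulrA -expr2 (le_trans h2)// ler_wpM2l.
rewrite ler_pM2r// leNgt => /negP; apply.
rewrite /wt ltr_pdivrMr ?exprn_gt0// mulrC -ltr_pdivrMr//.
apply: (lt_trans kC); rewrite -natrX ltr_nat.
by apply: (ltn_trans (ltnSn k)); exact: ltn_expl.
Qed.

End forcing.

(** * The family of skew products *)

Theorem mainTheorem10 (R : realType) (a delta C alpha : R)
    (a_gt0 : 0 < a) (a_le1 : a <= 1)
    (delta_ge0 : 0 <= delta) (delta_lt1 : delta < 1)
    (C_gt0 : 0 < C)
    (alpha_irr : irrational alpha)
    (mu_gt : ((1 + a / (1 - delta))%:E < irrationality_measure alpha)%E) :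
  exists F : set (torus R -> torus R),
    (F #= [set: R])%card /\
    forall f, F f ->
      [/\ exists h : circle R -> circle R,
            [/\ continuous h, has_degree h 0 & f = skew_product alpha h],
          holder a f,
          has_deviation C delta f,
          forall a' : R, a < a' -> a' <= 1 -> ~ holder a' f &
          forall C' delta' : R, 0 < C' -> 0 <= delta' -> delta' < delta ->
            ~ has_deviation C' delta' f].
Proof.
have a01 : 0 < a <= 1 by rewrite a_gt0.
have de01 : 0 <= delta < 1 by rewrite delta_ge0.
have chord_alpha := chord_gt0_irrational alpha alpha_irr.
have pi0 := @pi_gt0 R.
have [pq pqP] := choice (fun k : nat => exists_good_approximation alpha a delta
  a_gt0 delta_lt1 alpha_irr mu_gt _ (exprn_gt0 k (wt_gt0 k))).
have small k : 0 < `|offset alpha (pq k)| <= wt k ^+ k by case: (pqP k).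
have good k : `|offset alpha (pq k)| `^ (1 - delta) * (pq k).2%:R `^ a <= 1.
  by case: (pqP k).
(* The waves and the cusp each use half of the constant C. *)
pose ka := C / (4 * pi).
have ka0 : 0 < ka by rewrite divr_gt0// mulr_gt0.
have kaE : 2 * pi * ka = C / 2.
  rewrite /ka; move: pi pi0 => p p0.
  by field; rewrite gt_eqF.
pose eta0 : R := Num.min (C / 2) 2^-1.
have eta00 : 0 < eta0 by rewrite lt_min divr_gt0//= invr_gt0.
(* An injection of the line into the admissible values ]0, eta0[ of eta; the
   bound 1/2 on eta0 keeps the forcings distinct modulo 1 at the origin. *)
pose et (t : R) := eta0 / (1 + expR t).
have e1 (t : R) : 1 < 1 + expR t by rewrite ltrDl expR_gt0.
have p0 t : 0 < 1 + expR t := lt_trans ltr01 (e1 t).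
have et0 t : 0 < et t by rewrite divr_gt0.
have et_le t : et t <= eta0.
  by rewrite ler_pdivrMr// ler_peMr ?(ltW eta00) ?(ltW (e1 t)).
have et_inj : injective et.
  move=> s t /(mulfI (lt0r_neq0 eta00)) /invr_inj /addrI; exact: expR_inj.
pose H t := forcing alpha a delta ka (et t) pq.
have pH t : int_periodic (H t) by move=> x m; exact: forcing_periodic.
have cH t : continuous (H t) by exact: forcing_continuous.
have birkhoffE t n x : birkhoff_sum alpha (H t) n x =
    cocycle alpha a delta ka (et t) pq x (n%:R * alpha).
  exact: birkhoff_sum_forcing.
have birkhoff_le t n x : (0 < n)%N ->
    `|birkhoff_sum alpha (H t) n x| <= C * n%:R `^ delta.
  move=> n0; rewrite birkhoffE.
  apply: (le_trans (norm_cocycle_le _ _ _ _ _ _ a01 de01 ka0 (et0 t) small x n)).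
  have n1 : 1 <= n%:R `^ delta.
    by rewrite -[leLHS](powRr0 n%:R) ler_powR// ler1n.
  have : et t <= C / 2 by rewrite (le_trans (et_le t))// ge_min lexx.
  by rewrite kaE; nra.
pose f t := skew_product alpha (descend (H t)).
have f_inj : injective f.
  move=> s t st; apply: et_inj.
  have : f s (circle_proj 0, circle_proj 0) = f t (circle_proj 0, circle_proj 0).
    by rewrite st.
  move=> [] /addrI; rewrite !descend_proj// => /circle_projP[m].
  rewrite /H /forcing /cocycle add0r chord0 powR0 ?gt_eqF// !subr0 => /eqP.
  rewrite addrAC (inj_eq (addIr _)) addrC -subr_eq -mulrBl => /eqP em.
  have ca : 0 < chord alpha `^ a <= 1.
    rewrite powR_gt0//= -[leRHS](powRr0 (chord alpha)).
    by rewrite ger_powR ?chord_alpha ?chord_le1// ltW.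
  have half t' : 0 < et t' <= 2^-1.
    by rewrite et0 (le_trans (et_le t'))// ge_min lexx orbT.
  have m1 : `|m%:~R| < 1 :> R.
    by rewrite -em ltr_norml; have := half s; have := half t; nra.
  have m0 : m = 0 by move: m1; rewrite -intr_norm ltrz1; case: m {em} => [[|?]|?].
  move/eqP: em; rewrite m0 mulf_eq0 subr_eq0 (gt_eqF (proj1 (andP ca))) orbF.
  by move/eqP.
exists (range f); split; first by apply: inj_card_eq => s t _ _; exact: f_inj.
move=> _ [t _ <-]; split.
- exists (descend (H t)); split => //; first exact: descend_continuous.
  exists (H t); split => // x; first by rewrite descend_proj.
  by rewrite addr0 (pH t x 1).
- have [M [M0 hM]] := forcing_holder _ _ _ _ _ _ a01 de01 ka0 (et0 t) small good.
  exact: (holder_skew _ _ (pH t) _ _ a01 M0 hM).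
- exact: (has_deviation_skew _ _ (pH t) (cH t) _ _ delta_lt1 (birkhoff_le t)).
- move=> a' aa' _ /holder_skew_local -[|||M [r [r0]]] //.
    by rewrite (le_trans (ltW a_gt0)) ?ltW.
  exact: forcing_not_holder.
- move=> C' delta' _ d0 d'd dev.
  apply: (birkhoff_sum_unbounded _ _ _ _ _ _
    a01 de01 ka0 (et0 t) small _ _ d'd d0) => n n0.
  rewrite -birkhoffE.
  exact: (birkhoff_sum_le_deviation _ _ (pH t) (cH t) _ _
    delta_lt1 (birkhoff_le t) _ _ _ dev n0).
Qed.
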